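(* Let $p_0:=\log 4/\log 6$. Let $m\ge 1$ be an integer, and let $x_0\ge x_1\ge 0$ and $y_0\ge y_1\ge\cdots\ge y_m\ge 0$ be real numbers. Then $$\sum_{k=0}^{m+1}\left(\max_{\substack{i+j=k\\ 0\le i\le 1\\ 0\le j\le m}}x_iy_j\right)^{p_0}\ge (x_0+x_1)^{p_0}\left(\sum_{j=0}^m y_j\right)^{p_0}.$$ Moreover, for every $m\ge 2$, no larger exponent can hold uniformly: for every integer $m\ge 2$ and every real $p>p_0$ there exist real numbers $x_0\ge x_1\ge 0$ and $y_0\ge\cdots\ge y_m\ge 0$ for which the displayed inequality with $p_0$ replaced by $p$ fails.
   Context: Convention: $0^p=0$ for $p>0$. *)

(* Defs.v *)
From mathcomp Require Import all_boot all_order all_algebra.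
From mathcomp Require Import reals exp.
Import Order.TTheory GRing.Theory Num.Theory.

Set Implicit Arguments.
Unset Strict Implicit.
Unset Printing Implicit Defensive.

Local Open Scope ring_scope.

Definition p0 (R : realType) : R := ln 4 / ln 6.

Definition nonincr_nonneg (R : realType) (n : nat) (a : 'I_n -> R) : Prop :=
  (forall i j : 'I_n, (i <= j)%N -> a j <= a i) /\ (forall i, 0 <= a i).

(* The default value 0 of the iterated maximum is harmless: it is only used for
   nonnegative x and y, and for k <= m + 1 the index set is nonempty. *)
Definition max_conv (R : realType) (m : nat) (x : 'I_2 -> R) (y : 'I_m.+1 -> R)
    (k : nat) : R :=
  \big[Num.max/0]_(ij : 'I_2 * 'I_m.+1 | (ij.1 + ij.2)%N == k) (x ij.1 * y ij.2).

(* [powR] satisfies 0 `^ p = 0 for p != 0, see [powR0]. *)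
Definition power_ineq (R : realType) (m : nat) (p : R) (x : 'I_2 -> R)
    (y : 'I_m.+1 -> R) : Prop :=
  (x ord0 + x ord_max) `^ p * (\sum_(j < m.+1) y j) `^ p
    <= \sum_(k < m.+2) max_conv x y k `^ p.

(* Main.v *)
Require Import Defs.
From mathcomp Require Import all_boot all_order all_algebra.
From mathcomp Require Import ring lra.
From mathcomp Require Import reals exp.
Import Order.TTheory GRing.Theory Num.Theory.
Local Open Scope ring_scope.

Set Implicit Arguments.
Unset Strict Implicit.
Unset Printing Implicit Defensive.

(** Write p for p0, so that 6 ^ p = 4, and normalise x_0 = 1, x_1 = t, with
    s = t ^ p. Encode y by its first term and the ratios c_k = y_k / y_(k-1),
    which lie in [0, 1]. Divided by y_0 ^ p, the two sides become
    ((1 + t) (1 + S)) ^ p and 1 + M, where S ([ratio_sum]) and M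
    ([ratio_max]) are computed from the list of ratios by
    S (c :: l) = c (1 + S l) and M (c :: l) = max(c, t) ^ p + c ^ p M l.

    Reduction to words. As a function of u = c_k ^ p, the side 1 + M is affine
    on [0, s] and on [s, 1], while the other side is a norm in L^(1/p), hence
    convex in u. So each ratio can be moved to 0, t or 1, and the ratio 0 just
    ends the list ([ratio_reduction]). What remains is the inequality for words
    in the letters 1 and t ([word_ineq]).

    Induction on words. Deleting the first term y_0 = 1 from a word leaves a
    sequence with sum S and lowers the sum of the maxima by exactly 1, so the
    induction step holds as soon as
    ((1 + t) (1 + S)) ^ p <= 1 + ((1 + t) S) ^ p. By concavity of the power
    this only gets easier as S grows, and it holds for S at least
    [removal_threshold] t = 3 t (1 + 4 t) / 5 ([removal]). That threshold is
    small enough to leave only eight words, with at most four terms in all: the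
    sequences (1), (1,1), (1,1,1), (1,1,t), (1,t), (1,t,t), (1,t,t^2) and
    (1,t,t^2,t^3), all but the first only for t bounded away from 0.
    Each is an inequality in the single variable t:
    - constant sequences and (1,t,t) follow from convexity of the norm in s and
      from 2 ^ p <= 2, 4 ^ p <= 3, 6 ^ p = 4 ([constant_ineq], [one_two_ineq]);
    - (1,1,t) follows from AM-GM, (1,t) from one chord of (1 + t) ^ p;
    - (1,t,t^2) and (1,t,t^2,t^3) are so tight near t = 1 that second order
      matters. Power means increase with the exponent, so p may be lowered to
      3/4, where everything is polynomial in t ^ (1/4), and palindromic
      ([mean_of_powers], [geometric3_ineq], [geometric4_ineq]).

    Sharpness: for x = (1, 1) and y = (1, 1, 1, 0, ..., 0) the inequality reads
    4 >= 6 ^ p, which fails once p > p0. *)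

(** * Convexity of real powers *)

Lemma ler_powRp (R : realType) (p x y : R) :
  0 <= p -> 0 <= x -> x <= y -> x `^ p <= y `^ p.
Proof.
move=> p_ge0 x_ge0 xy; apply: ge0_ler_powR => //; rewrite nnegrE //.
exact: le_trans xy.
Qed.

Lemma powRV (R : realType) (p x : R) : 0 <= x -> x^-1 `^ p = (x `^ p)^-1.
Proof. by move=> x_ge0; rewrite -!powR_inv1 ?powR_ge0 // powRAC. Qed.

Lemma powRXn (R : realType) (p x : R) n : 0 <= x -> (x ^+ n) `^ p = x `^ p ^+ n.
Proof. by move=> x_ge0; rewrite -powR_mulrn // powRAC powR_mulrn ?powR_ge0. Qed.

(** Young's inequality for x ^ p and 1 with the conjugate exponents 1 / p and
    1 / (1 - p). *)
Lemma powR_bernoulli (R : realType) (p x : R) :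
  0 < p -> p < 1 -> 0 <= x -> x `^ p <= 1 + p * (x - 1).
Proof.
move=> p_gt0 p_lt1 x_ge0.
have q_gt0 : 0 < 1 - p by rewrite subr_gt0.
have := @conjugate_powR R (x `^ p) 1 p^-1 (1 - p)^-1 (powR_ge0 _ _) ler01.
rewrite !invrK !invr_gt0 => /(_ p_gt0 q_gt0 (subrKC _ _)).
rewrite mulr1 powR1 -powRrM mulfV ?gt_eqF // powRr1 //.
by move=> /le_trans; apply; lra.
Qed.

(** The concave case for the exponent 1 / r, read at x ^ r. *)
Lemma powR_bernoulli_ge1 (R : realType) (r x : R) :
  1 <= r -> 0 <= x -> 1 + r * (x - 1) <= x `^ r.
Proof.
move=> r_ge1 x_ge0; have r_gt0 : 0 < r by apply: lt_le_trans r_ge1.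
have [<-|r_neq1] := eqVneq 1 r; first by rewrite powRr1 //; lra.
have r_gt1 : 1 < r by rewrite lt_neqAle r_neq1.
have rV_lt1 : r^-1 < 1 by rewrite invf_lt1.
have rV_gt0 : 0 < r^-1 by rewrite invr_gt0.
have := @powR_bernoulli _ _ (x `^ r) rV_gt0 rV_lt1 (powR_ge0 _ _).
rewrite -powRrM mulfV ?gt_eqF // powRr1 // => le_x.
have /(ler_wpM2l (ltW r_gt0)) := le_x.
by rewrite mulrDr mulrA mulfV ?gt_eqF //; lra.
Qed.

Lemma powR_concave (R : realType) (p l a b : R) :
  0 < p -> p < 1 -> 0 <= l <= 1 -> 0 <= a -> 0 <= b ->
  l * a `^ p + (1 - l) * b `^ p <= (l * a + (1 - l) * b) `^ p.
Proof.
move=> p_gt0 p_lt1 /andP[l_ge0 l_le1] a_ge0 b_ge0.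
set m := l * a + (1 - l) * b.
have la_ge0 : 0 <= l * a by apply: mulr_ge0.
have lb_ge0 : 0 <= (1 - l) * b by apply: mulr_ge0; rewrite // subr_ge0.
have := addr_ge0 la_ge0 lb_ge0; rewrite -/m le_eqVlt => /predU1P[m0|m_gt0].
  have aux u v : 0 <= u -> u * v = 0 -> u * v `^ p = 0.
    move=> _ /eqP; rewrite mulf_eq0 => /orP[]/eqP->; first by rewrite mul0r.
    by rewrite powR0 ?mulr0 // gt_eqF.
  rewrite (aux l a) // ?(aux (1 - l) b) ?subr_ge0 ?addr0 ?powR_ge0 //.
  - by move: m0; rewrite /m; lra.
  - by move: m0; rewrite /m; lra.
(* both powers lie below the tangent at the mean m *)
have tangent c : 0 <= c -> c `^ p <= m `^ p * (1 + p * (c / m - 1)).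
  move=> c_ge0.
  have {1}-> : c = m * (c / m) by rewrite mulrC divfK // gt_eqF.
  rewrite powRM ?divr_ge0 ?(ltW m_gt0) //.
  rewrite ler_wpM2l ?powR_ge0 //.
  by apply: powR_bernoulli; rewrite // divr_ge0 // ltW.
have /(ler_wpM2l l_ge0) ta := tangent a a_ge0.
have lC_ge0 : 0 <= 1 - l by rewrite subr_ge0.
have /(ler_wpM2l lC_ge0) tb := tangent b b_ge0.
apply: le_trans (lerD ta tb) _; rewrite le_eqVlt; apply/orP; left; apply/eqP.
have -> : l * (m `^ p * (1 + p * (a / m - 1))) +
  (1 - l) * (m `^ p * (1 + p * (b / m - 1))) =
  m `^ p * (1 + p * ((l * a + (1 - l) * b) / m - 1)) by ring.
by rewrite -/m mulfV ?gt_eqF //; ring.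
Qed.

(** Jensen: each summand lies above the tangent of the convex power at the mean m,
    and the linear terms cancel in the sum. *)
Lemma power_mean (R : realType) (r m : R) (xs : seq R) :
  1 <= r -> 0 < m -> all (fun x => 0 <= x) xs ->
  \sum_(x <- xs) x = (size xs)%:R * m ->
  (size xs)%:R * m `^ r <= \sum_(x <- xs) x `^ r.
Proof.
move=> r_ge1 m_gt0 /allP xs_ge0 sum_xs.
have tangent x : x \in xs -> m `^ r * (1 + r * (x / m - 1)) <= x `^ r.
  move=> /xs_ge0 x_ge0.
  have {2}-> : x = m * (x / m) by rewrite mulrC divfK // gt_eqF.
  have xm_ge0 : 0 <= x / m by rewrite divr_ge0 // ltW.
  rewrite powRM ?(ltW m_gt0) // ler_wpM2l ?powR_ge0 //.
  exact: powR_bernoulli_ge1.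
rewrite big_seq; apply: le_trans (ler_sum _ tangent); rewrite -big_seq.
rewrite -mulr_sumr big_split /= -mulr_sumr sumrB -mulr_suml sum_xs.
rewrite big_const_seq count_predT iter_addr_0 mulfK ?gt_eqF //.
by rewrite subrr mulr0 addr0 mulrC.
Qed.

(** Minkowski's inequality for the norm of L^(1/p): r is the p-mean of a and b,
    that is, r ^ p is the convex combination, so this is convexity of the norm of
    the pair (C ^ p, B ^ p u) in the variable u = r ^ p. *)
Lemma powR_mean_convex (R : realType) (p l C B a b r : R) :
  0 < p -> p < 1 -> 0 <= l <= 1 ->
  0 < C -> 0 <= B -> 0 <= a -> 0 <= b -> 0 <= r ->
  r `^ p = l * a `^ p + (1 - l) * b `^ p ->
  (C + B * r) `^ p <= l * (C + B * a) `^ p + (1 - l) * (C + B * b) `^ p.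
Proof.
move=> p_gt0 p_lt1 l01 C_gt0 B_ge0 a_ge0 b_ge0 r_ge0 rE.
have /andP[l_ge0 l_le1] := l01.
have lC_ge0 : 0 <= 1 - l by rewrite subr_ge0.
set u := C + B * a; set v := C + B * b.
have u_gt0 : 0 < u by rewrite ltr_wpDr // mulr_ge0.
have v_gt0 : 0 < v by rewrite ltr_wpDr // mulr_ge0.
have up_gt0 : 0 < u `^ p by apply: powR_gt0.
have vp_gt0 : 0 < v `^ p by apply: powR_gt0.
set D := l * u `^ p + (1 - l) * v `^ p.
have D_gt0 : 0 < D.
  have [l0|l_neq0] := eqVneq l 0; first by rewrite /D l0; lra.
  rewrite /D ltr_wpDr ?mulr_ge0 // ?(ltW vp_gt0) // mulr_gt0 // lt0r.
  by rewrite l_neq0.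
pose E := D `^ p^-1.
have E_gt0 : 0 < E by apply: powR_gt0.
have EpE : E `^ p = D.
  by rewrite /E -powRrM mulVf ?gt_eqF // powRr1 // ltW.
(* normalising the two endpoints to norm 1 turns the weights l into m *)
set m := l * u `^ p / D.
have mC : 1 - m = (1 - l) * v `^ p / D.
  by rewrite /m -[X in X - _](divff (lt0r_neq0 D_gt0)) {1}/D; ring.
have m01 : 0 <= m <= 1.
  apply/andP; split; first by rewrite divr_ge0 ?mulr_ge0 // ltW.
  by rewrite -subr_ge0 mC divr_ge0 ?mulr_ge0 // ltW.
have component g h k : 0 <= g -> 0 <= h -> 0 <= k ->
    g `^ p = l * h `^ p + (1 - l) * k `^ p ->
    g <= E * (m * (h / u) + (1 - m) * (k / v)).
  move=> g_ge0 h_ge0 k_ge0 gE; have [m_ge0 m_le1] := andP m01.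
  have mean_ge0 : 0 <= m * (h / u) + (1 - m) * (k / v).
    by rewrite addr_ge0 // mulr_ge0 ?subr_ge0 // divr_ge0 // ltW.
  have le_pow : g `^ p <= (E * (m * (h / u) + (1 - m) * (k / v))) `^ p.
    rewrite powRM ?(ltW E_gt0) // EpE.
    have hu_ge0 : 0 <= h / u by rewrite divr_ge0 // ltW.
    have kv_ge0 : 0 <= k / v by rewrite divr_ge0 // ltW.
    have := powR_concave p_gt0 p_lt1 m01 hu_ge0 kv_ge0.
    move/(ler_wpM2l (ltW D_gt0)); apply: le_trans.
    rewrite !powRM ?invr_ge0 ?(ltW u_gt0) ?(ltW v_gt0) //.
    rewrite !powRV ?(ltW u_gt0) ?(ltW v_gt0) // gE.
    rewrite mC /m le_eqVlt; apply/orP; left; apply/eqP; field.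
    by rewrite !gt_eqF.
  rewrite leNgt; apply/negP => lt_g.
  have := @gt0_ltr_powR R p p_gt0 _ _ _ _ lt_g.
  rewrite !nnegrE mulr_ge0 ?(ltW E_gt0) // => /(_ isT g_ge0).
  by rewrite ltNge le_pow.
have Cle := component C C C (ltW C_gt0) (ltW C_gt0) (ltW C_gt0).
have Ble := component (B * r) (B * a) (B * b).
rewrite -EpE; apply: ler_powRp; rewrite ?(ltW p_gt0) //.
  by rewrite addr_ge0 ?mulr_ge0 // ltW.
apply: le_trans (lerD (Cle _) (Ble _ _ _ _)) _; rewrite ?mulr_ge0 //.
- by ring.
- by rewrite !powRM // rE; ring.
have -> : E * (m * (C / u) + (1 - m) * (C / v)) +
    E * (m * (B * a / u) + (1 - m) * (B * b / v)) =
    E * (m * (u / u) + (1 - m) * (v / v)) by rewrite /u /v; ring.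
by rewrite !divff ?gt_eqF //; lra.
Qed.

(** Convexity in t ^ p, between the endpoints t = 0 and t = 1. *)
Lemma powR_interp (R : realType) (p t a b : R) :
  0 < p -> p < 1 -> 0 <= t <= 1 -> 0 < a -> 0 <= b ->
  (a + t * b) `^ p <= (1 - t `^ p) * a `^ p + t `^ p * (a + b) `^ p.
Proof.
move=> p_gt0 p_lt1 /andP[t_ge0 t_le1] a_gt0 b_ge0.
have tp01 : 0 <= t `^ p <= 1.
  rewrite powR_ge0 /=; have <- : 1 `^ p = 1 :> R by rewrite powR1.
  by apply: ler_powRp => //; exact: ltW.
have tE : t `^ p = t `^ p * 1 `^ p + (1 - t `^ p) * 0 `^ p.
  by rewrite powR1 powR0 ?gt_eqF //; ring.
have := powR_mean_convex p_gt0 p_lt1 tp01 a_gt0 b_ge0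
  ler01 (lexx 0) t_ge0 tE.
by rewrite mulr1 mulr0 addr0 [t * b]mulrC [X in _ -> _ <= X]addrC.
Qed.

(** * The cone x ^ p + y ^ p >= z ^ p *)

Definition pcone (R : realType) (p x y z : R) : Prop :=
  [/\ 0 <= x, 0 <= y, 0 <= z & z `^ p <= x `^ p + y `^ p].

(** The cone is convex because (x, y) |-> (x ^ p + y ^ p) ^ (1/p) is
    superadditive for p < 1; after scaling both points to z = 1 this is concavity
    of the power. *)
Lemma pconeD (R : realType) (p x0 y0 z0 x1 y1 z1 : R) : 0 < p -> p < 1 ->
  pcone p x0 y0 z0 -> pcone p x1 y1 z1 ->
  pcone p (x0 + x1) (y0 + y1) (z0 + z1).
Proof.
move=> p_gt0 p_lt1 [x0_ge0 y0_ge0 z0_ge0 le0] [x1_ge0 y1_ge0 z1_ge0 le1].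
split; rewrite ?addr_ge0 //.
have mono u v : 0 <= u -> u <= v -> u `^ p <= v `^ p.
  by apply: ler_powRp; exact: ltW.
have [z0_0|z0_neq0] := eqVneq z0 0.
  rewrite z0_0 add0r (le_trans le1) // lerD // mono // ?lerDr //.
have [z1_0|z1_neq0] := eqVneq z1 0.
  rewrite z1_0 addr0 (le_trans le0) // lerD // mono // ?lerDl //.
have z0_gt0 : 0 < z0 by rewrite lt0r z0_neq0.
have z1_gt0 : 0 < z1 by rewrite lt0r z1_neq0.
set z := z0 + z1; have z_gt0 : 0 < z by rewrite addr_gt0.
set l := z0 / z.
have lC : 1 - l = z1 / z by rewrite /l /z; field; rewrite gt_eqF.
have l01 : 0 <= l <= 1.
  apply/andP; split; first by rewrite divr_ge0 // ltW.
  by rewrite -subr_ge0 lC divr_ge0 // ltW.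
have split_pow u v : 0 <= u -> 0 <= v -> z `^ p *
    (l * (u / z0) `^ p + (1 - l) * (v / z1) `^ p) <= (u + v) `^ p.
  move=> u_ge0 v_ge0.
  have -> : u + v = z * (l * (u / z0) + (1 - l) * (v / z1)).
    by rewrite lC /l; field; rewrite ?gt_eqF.
  have mean_ge0 : 0 <= l * (u / z0) + (1 - l) * (v / z1).
    by rewrite lC addr_ge0 // mulr_ge0 // divr_ge0 // ltW.
  rewrite powRM ?(ltW z_gt0) // ler_wpM2l ?powR_ge0 //.
  by apply: powR_concave; rewrite // divr_ge0 // ltW.
apply: le_trans (lerD (split_pow x0 x1 x0_ge0 x1_ge0)
                      (split_pow y0 y1 y0_ge0 y1_ge0)).
rewrite -mulrDr -[X in X <= _]mulr1 ler_wpM2l ?powR_ge0 //.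
have unit_sum u v w : 0 <= u -> 0 <= v -> 0 < w -> w `^ p <= u `^ p + v `^ p ->
    1 <= (u / w) `^ p + (v / w) `^ p.
  move=> u_ge0 v_ge0 w_gt0 le_w.
  have wV_ge0 : 0 <= w^-1 by rewrite invr_ge0 ltW.
  rewrite !powRM // -mulrDl.
  have wp_gt0 : 0 < w `^ p by rewrite powR_gt0.
  rewrite powRV ?(ltW w_gt0) //.
  by rewrite ler_pdivlMr // mul1r.
have u0 := unit_sum _ _ _ x0_ge0 y0_ge0 z0_gt0 le0.
have u1 := unit_sum _ _ _ x1_ge0 y1_ge0 z1_gt0 le1.
case/andP: l01 => l_ge0 l_le1.
have lC_ge0 : 0 <= 1 - l by rewrite subr_ge0.
have := lerD (ler_wpM2l l_ge0 u0) (ler_wpM2l lC_ge0 u1).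
by lra.
Qed.

Lemma pconeZ (R : realType) (p c x y z : R) : 0 <= c ->
  pcone p x y z -> pcone p (c * x) (c * y) (c * z).
Proof.
move=> c_ge0 [x_ge0 y_ge0 z_ge0 le_z]; split; rewrite ?mulr_ge0 //.
by rewrite !powRM // -mulrDr ler_wpM2l ?powR_ge0.
Qed.

(** Two points of the cone, seen in the plane x = 1, certify the inequality for
    all W between their slopes y / x: there Z may be anything up to the chord that
    joins them. The determinant clears the denominators. *)
Lemma pcone_chord (R : realType) (p x0 y0 z0 x1 y1 z1 W Z : R) :
  0 < p -> p < 1 -> pcone p x0 y0 z0 -> pcone p x1 y1 z1 ->
  0 < x0 * y1 - x1 * y0 -> y0 <= W * x0 -> W * x1 <= y1 -> 0 <= Z ->
  Z * (x0 * y1 - x1 * y0) <= z0 * (y1 - W * x1) + z1 * (W * x0 - y0) ->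
  Z `^ p <= 1 + W `^ p.
Proof.
move=> p_gt0 p_lt1 c0 c1; set D := x0 * y1 - x1 * y0 => D_gt0 W0 W1 Z_ge0 leZ.
have a_ge0 : 0 <= (y1 - W * x1) / D by apply: divr_ge0 (ltW D_gt0); rewrite subr_ge0.
have b_ge0 : 0 <= (W * x0 - y0) / D by apply: divr_ge0 (ltW D_gt0); rewrite subr_ge0.
have D_neq0 : D != 0 by rewrite gt_eqF.
have [_ _ _] := pconeD p_gt0 p_lt1 (pconeZ a_ge0 c0)
  (pconeZ b_ge0 c1).
have -> : (y1 - W * x1) / D * x0 + (W * x0 - y0) / D * x1 = 1.
  by rewrite -[RHS](divff D_neq0) /D; ring.
have -> : (y1 - W * x1) / D * y0 + (W * x0 - y0) / D * y1 = W.
  by rewrite -[RHS](mulfK D_neq0) /D; ring.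
rewrite powR1; apply: le_trans; apply: ler_powRp => //; first exact: ltW.
have -> : (y1 - W * x1) / D * z0 + (W * x0 - y0) / D * z1 =
  (z0 * (y1 - W * x1) + z1 * (W * x0 - y0)) / D by ring.
by rewrite ler_pdivlMr.
Qed.

(** * Numerical facts about the exponent *)

Lemma ln6_gt0 (R : realType) : 0 < ln (6 : R).
Proof. by apply: ln_gt0; lra. Qed.

Lemma p0_gt0 (R : realType) : 0 < p0 R.
Proof. by rewrite /p0 divr_gt0 ?ln6_gt0 //; apply: ln_gt0; lra. Qed.

Lemma powR6_p0 (R : realType) : 6 `^ p0 R = 4.
Proof.
have six_neq0 : (6 == 0 :> R) = false by rewrite pnatr_eq0.
rewrite /powR six_neq0 /p0 divfK ?gt_eqF ?ln6_gt0 // lnK // posrE; lra.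
Qed.

Lemma p0_le_ratio (R : realType) (m n : nat) : (0 < n)%N ->
  (4 : R) ^+ n <= 6 ^+ m -> p0 R <= m%:R / n%:R.
Proof.
move=> n_gt0 le_pow; rewrite /p0 ler_pdivrMr ?ln6_gt0 // mulrAC.
rewrite ler_pdivlMr ?ltr0n // !(mulrC _ (ln _)) !mulr_natr -!lnXn ?ltr0n //.
by rewrite ler_ln ?posrE ?exprn_gt0 ?ltr0n.
Qed.

Lemma p0_ge_ratio (R : realType) (m n : nat) : (0 < n)%N ->
  (6 : R) ^+ m <= 4 ^+ n -> m%:R / n%:R <= p0 R.
Proof.
move=> n_gt0 le_pow; rewrite /p0 ler_pdivlMr ?ln6_gt0 // mulrAC.
rewrite ler_pdivrMr ?ltr0n // !(mulrC _ (ln _)) !mulr_natr -!lnXn ?ltr0n //.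
by rewrite ler_ln ?posrE ?exprn_gt0 ?ltr0n.
Qed.

(** The excess of 65 / 84 over p0 is about 10 ^ -4; the bound 8 ^ p <= 5, which
    rests on it, already fails at p0 + 3 * 10 ^ -4. *)
Lemma p0_le (R : realType) : p0 R <= 65 / 84.
Proof. by apply: (p0_le_ratio (m := 65) (n := 84)) => //; lra. Qed.

Lemma p0_ge (R : realType) : 3 / 4 <= p0 R.
Proof. by apply: (p0_ge_ratio (m := 3) (n := 4)) => //; lra. Qed.

Lemma p0_lt1 (R : realType) : p0 R < 1.
Proof. by apply: le_lt_trans (p0_le R) _; lra. Qed.

(** For bases below 1 an upper bound on the exponent gives a lower bound on the
    power, so rational lower bounds become comparisons of integers. *)
Lemma powR_p0_ge (R : realType) (x y : R) :
  0 < x -> x <= 1 -> 0 <= y -> y ^+ 84 <= x ^+ 65 -> y <= x `^ p0 R.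
Proof.
move=> x_gt0 x_le1 y_ge0 le_pow.
have le_p0 : x `^ (65 / 84) <= x `^ p0 R.
  by apply: ger_powR; rewrite ?x_gt0 //; exact: p0_le.
apply: le_trans le_p0; rewrite -(ler_pXn2r (n := 84)) ?nnegrE ?powR_ge0 //.
rewrite -[X in _ <= X]powR_mulrn ?powR_ge0 // -powRrM divfK ?pnatr_eq0 //.
by rewrite powR_mulrn // ltW.
Qed.

Lemma powR_p0_le1 (R : realType) (t : R) : 0 <= t <= 1 -> t `^ p0 R <= 1.
Proof.
move=> /andP[t_ge0 t_le1].
have <- : 1 `^ p0 R = 1 :> R by rewrite powR1.
by apply: ler_powRp => //; apply/ltW/p0_gt0.
Qed.

Lemma powR2_p0 (R : realType) : 2 `^ p0 R <= 171 / 100.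
Proof.
have : 100 / 171 <= 2^-1 `^ p0 R by apply: powR_p0_ge; lra.
rewrite powRV // => le_inv.
have pos : 0 < 2 `^ p0 R :> R by apply: powR_gt0.
have := ler_wpM2r (ltW pos) le_inv; rewrite mulVf ?gt_eqF //; lra.
Qed.

Lemma powR4_p0 (R : realType) : 4 `^ p0 R <= 3.
Proof.
have : 3^-1 <= 4^-1 `^ p0 R by apply: powR_p0_ge; lra.
by rewrite powRV // lef_pV2 // ?posrE ?powR_gt0 //; lra.
Qed.

Lemma powR8_p0 (R : realType) : 8 `^ p0 R <= 5.
Proof.
have : 5^-1 <= 8^-1 `^ p0 R by apply: powR_p0_ge; lra.
by rewrite powRV // lef_pV2 // ?posrE ?powR_gt0 //; lra.
Qed.

Lemma powR76_p0 (R : realType) : (7 / 6) `^ p0 R <= 80 / 71.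
Proof.
have : 71 / 80 <= (7 / 6)^-1 `^ p0 R by apply: powR_p0_ge; lra.
rewrite powRV // => [le_inv|]; last lra.
have pos : 0 < (7 / 6) `^ p0 R :> R by apply: powR_gt0; lra.
have := ler_wpM2r (ltW pos) le_inv; rewrite mulVf ?gt_eqF //; lra.
Qed.

(** The number a is a rational certificate that splits 1 between
    (x / z) ^ p and (y / z) ^ p. *)
Lemma pcone_p0 (R : realType) (a x y z : R) :
  0 < x -> x <= z -> 0 < y -> y <= z -> 0 <= a -> a <= 1 ->
  a ^+ 84 <= (x / z) ^+ 65 -> (1 - a) ^+ 84 <= (y / z) ^+ 65 ->
  pcone (p0 R) x y z.
Proof.
move=> x_gt0 xz y_gt0 yz a_ge0 a_le1 ax ay.
have z_gt0 : 0 < z by apply: lt_le_trans xz.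
have part b u : 0 < u -> u <= z -> 0 <= b -> b ^+ 84 <= (u / z) ^+ 65 ->
    b * z `^ p0 R <= u `^ p0 R.
  move=> u_gt0 uz b_ge0 le_pow.
  rewrite -[X in _ <= X `^ _](divfK (lt0r_neq0 z_gt0)).
  rewrite powRM ?divr_ge0 ?(ltW u_gt0) ?(ltW z_gt0) // ler_wpM2r ?powR_ge0 //.
  by apply: powR_p0_ge; rewrite ?divr_gt0 // ler_pdivrMr // mul1r.
split; rewrite ?(ltW x_gt0) ?(ltW y_gt0) ?(ltW z_gt0) //.
have := lerD (part _ _ x_gt0 xz a_ge0 ax) (part _ _ y_gt0 yz _ ay).
by rewrite -mulrDl subrKC mul1r; apply; rewrite subr_ge0.
Qed.

(** * Removing the first term *)

(** A compromise: high enough for [removal] to hold, with room for rational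
    estimates, and low enough to leave few short words. At t = 1 it is 3, where
    [removal] holds from about 2.945 on. *)
Definition removal_threshold (R : realType) (t : R) : R := 3 * t * (1 + 4 * t) / 5.

(** The integer points n0, ..., n7 are nearly on the boundary of the cone, and
    their slopes W = y / x run from 0 to 6, the value of W at t = 1. On each of
    the seven slope intervals the chord lies above W + 1 + t. In terms of t this
    is a cubic inequality, proved from tangents near its minimum. *)
Lemma pcone_removal (R : realType) (t W : R) :
  0 <= t <= 1 -> W = (1 + t) * removal_threshold t ->
  (W + (1 + t)) `^ p0 R <= 1 + W `^ p0 R.
Proof.
move=> /andP[t_ge0 t_le1] WE; rewrite /removal_threshold in WE.
have p_gt0 := p0_gt0 R; have p_lt1 := p0_lt1 R.
have chord := pcone_chord p_gt0 p_lt1.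
have n0 : pcone (p0 R) 1 0 1.
  by split; rewrite // powR1 powR0 ?gt_eqF // addr0.
have n1 : pcone (p0 R) 41 1 44 by apply: (pcone_p0 (a := 71 / 75)); lra.
have n2 : pcone (p0 R) 6 1 8.
  by split; rewrite // powR1 powR6_p0; have := powR8_p0 R; lra.
have n3 : pcone (p0 R) 7 3 12 by apply: (pcone_p0 (a := 27 / 41)); lra.
have n4 : pcone (p0 R) 4 5 11 by apply: (pcone_p0 (a := 37 / 81)); lra.
have n5 : pcone (p0 R) 4 12 19 by apply: (pcone_p0 (a := 41 / 137)); lra.
have n6 : pcone (p0 R) 10 46 65 by apply: (pcone_p0 (a := 27 / 115)); lra.
have n7 : pcone (p0 R) 1 6 8.
  by split; rewrite // powR1 powR6_p0; have := powR8_p0 R; lra.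
have cubic c : 0 <= c -> 3 * c ^+ 2 * t - 2 * c ^+ 3 <= t ^+ 3.
  move=> c_ge0; rewrite -subr_ge0.
  have -> : t ^+ 3 - (3 * c ^+ 2 * t - 2 * c ^+ 3) =
    (t - c) ^+ 2 * (t + 2 * c) by ring.
  by rewrite mulr_ge0 ?sqr_ge0 ?addr_ge0 ?mulr_ge0.
have square c : 2 * c * t - c ^+ 2 <= t ^+ 2.
  by have := sqr_ge0 (t - c); lra.
have t2_ge0 : 0 <= t ^+ 2 by apply: sqr_ge0.
have t3_ge0 : 0 <= t ^+ 3 by apply: exprn_ge0.
have W_ge0 : 0 <= W by lra.
have Z_ge0 : 0 <= W + (1 + t) by lra.
have W_le6 : W <= 6.
  have : t ^+ 2 <= 1 by rewrite exprn_ile1.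
  have : t ^+ 3 <= 1 by rewrite exprn_ile1.
  by lra.
have [le1|gt1] := lerP (W * 41) 1.
  by apply: (chord _ _ _ _ _ _ _ _ n0 n1); lra.
have [le2|gt2] := lerP (W * 6) 1.
  have /cubic tc : 0 <= 1 / 11 :> R by lra.
  have ts := square (1 / 11).
  by apply: (chord _ _ _ _ _ _ _ _ n1 n2); lra.
have [le3|gt3] := lerP (W * 7) 3.
  have /cubic tc : 0 <= 1 / 5 :> R by lra.
  have ts := square (1 / 5).
  by apply: (chord _ _ _ _ _ _ _ _ n2 n3); lra.
have [le4|gt4] := lerP (W * 4) 5.
  have /cubic tc : 0 <= 3 / 8 :> R by lra.
  have ts := square (3 / 8).
  by apply: (chord _ _ _ _ _ _ _ _ n3 n4); lra.
have [le5|gt5] := lerP (W * 4) 12.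
  have /cubic tc : 0 <= 43 / 70 :> R by lra.
  have ts := square (43 / 70).
  by apply: (chord _ _ _ _ _ _ _ _ n4 n5); lra.
have [le6|gt6] := lerP (W * 10) 46.
  have /cubic tc : 0 <= 4 / 5 :> R by lra.
  have ts := square (4 / 5).
  by apply: (chord _ _ _ _ _ _ _ _ n5 n6); lra.
have /cubic tc : 0 <= 1 :> R by lra.
have ts := square 1.
by apply: (chord _ _ _ _ _ _ _ _ n6 n7); lra.
Qed.

(** Adding (0, h, h) to a point of the cone stays in the cone, so the case of the
    threshold gives all larger w. *)
Lemma removal (R : realType) (t w : R) : 0 <= t <= 1 -> removal_threshold t <= w ->
  ((1 + t) * (1 + w)) `^ p0 R <= 1 + ((1 + t) * w) `^ p0 R.
Proof.
move=> t01 le_w; have /andP[t_ge0 t_le1] := t01.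
have p_gt0 := p0_gt0 R.
have thr_ge0 : 0 <= removal_threshold t.
  by rewrite /removal_threshold !mulr_ge0 ?invr_ge0 //; lra.
set W := (1 + t) * removal_threshold t.
have W_ge0 : 0 <= W by rewrite mulr_ge0 //; lra.
have c0 : pcone (p0 R) 1 W (W + (1 + t)).
  by split; rewrite ?powR1 //; [lra | apply: pcone_removal].
set h := (1 + t) * (w - removal_threshold t).
have h_ge0 : 0 <= h by rewrite mulr_ge0 ?subr_ge0 //; lra.
have c1 : pcone (p0 R) 0 h h by split; rewrite // powR0 ?add0r // gt_eqF.
have [_ _ _] := pconeD p_gt0 (p0_lt1 R) c0 c1.
rewrite addr0 powR1.
have -> : W + (1 + t) + h = (1 + t) * (1 + w) by rewrite /W /h; ring.
by have -> : W + h = (1 + t) * w by rewrite /W /h; ring.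
Qed.

(** * The short words *)

(** By convexity in t ^ p, the cases t = 0 and t = 1 suffice. In the applications
    a = c is the number of equal terms. *)
Lemma constant_ineq (R : realType) (t a c : R) : 0 <= t <= 1 -> 0 < a ->
  a `^ p0 R <= c -> (2 * a) `^ p0 R <= c + 1 ->
  ((1 + t) * a) `^ p0 R <= c + t `^ p0 R.
Proof.
move=> t01 a_gt0 le_a le_2a.
have := powR_interp (p0_gt0 R) (p0_lt1 R) t01 a_gt0 (ltW a_gt0).
have -> : a + t * a = (1 + t) * a by ring.
have -> : a + a = 2 * a by ring.
move=> /le_trans; apply.
have s_ge0 : 0 <= t `^ p0 R by apply: powR_ge0.
have sC_ge0 : 0 <= 1 - t `^ p0 R by rewrite subr_ge0; apply: powR_p0_le1.
have := lerD (ler_wpM2l sC_ge0 le_a) (ler_wpM2l s_ge0 le_2a).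
lra.
Qed.

(** Interpolating twice gives (1 - s) + s ((1 - s) 4 ^ p + s 6 ^ p). *)
Lemma one_two_ineq (R : realType) (t : R) : 0 <= t <= 1 ->
  ((1 + t) * (1 + 2 * t)) `^ p0 R <= 1 + 2 * t `^ p0 R + (t `^ p0 R) ^+ 2.
Proof.
move=> t01; have /andP[t_ge0 t_le1] := t01.
have interp := powR_interp (p0_gt0 R) (p0_lt1 R) t01.
have -> : (1 + t) * (1 + 2 * t) = 1 + t * (3 + t * 2) by ring.
have le1 := interp 1 (3 + t * 2) ltr01 _.
have le2 := interp 4 2 _ _.
have s_ge0 : 0 <= t `^ p0 R by apply: powR_ge0.
have sC_ge0 : 0 <= 1 - t `^ p0 R by rewrite subr_ge0; apply: powR_p0_le1.
apply: le_trans (le1 _) _; first by lra.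
have -> : 1 + (3 + t * 2) = 4 + t * 2 by ring.
have /(_ _ _)/(ler_wpM2l s_ge0) := le2.
have -> : 4 + 2 = 6 :> R by ring.
rewrite powR6_p0 powR1.
have := ler_wpM2l s_ge0 (ler_wpM2l sC_ge0 (powR4_p0 R)).
move=> h1 h2; have {}h2 := h2 _ _; lra.
Qed.

(** The hypothesis says that t > 1 / 6. On this range (1 + t) ^ p lies below the
    chord, as a function of s, through t = 1 / 6, where s = 1 / 4 exactly, and
    t = 1. The square of that chord still lies below 1 + s + s ^ 2. *)
Lemma one_one_ineq (R : realType) (t : R) : 0 <= t <= 1 ->
  t < removal_threshold t ->
  ((1 + t) * (1 + t)) `^ p0 R <= 1 + t `^ p0 R + (t `^ p0 R) ^+ 2.
Proof.
move=> /andP[t_ge0 t_le1]; rewrite /removal_threshold => t_big.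
have t_gt : 1 / 6 < t by nra.
set s := t `^ p0 R.
have s_le1 : s <= 1 by apply: powR_p0_le1; rewrite t_ge0.
have s6 : 6^-1 `^ p0 R = 4^-1 :> R by rewrite powRV // powR6_p0.
have s_ge : 4^-1 <= s by rewrite -s6; apply: ler_powRp; rewrite ?ltW ?p0_gt0 //; lra.
pose l := (1 - s) * 4 / 3.
have l01 : 0 <= l <= 1 by apply/andP; rewrite /l; split; lra.
have sE : s = l * 6^-1 `^ p0 R + (1 - l) * 1 `^ p0 R.
  by rewrite s6 powR1 /l; field.
have inv6_ge0 : 0 <= 6^-1 :> R by lra.
have := powR_mean_convex (p0_gt0 R) (p0_lt1 R) l01 ltr01 ler01 inv6_ge0 ler01 t_ge0 sE.
rewrite !mul1r.
have -> : 1 + 6^-1 = 7 / 6 :> R by field.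
have -> : 1 + 1 = 2 :> R by ring.
have /andP[l_ge0 l_le1] := l01.
have lC_ge0 : 0 <= 1 - l by rewrite subr_ge0.
have bound := lerD (ler_wpM2l l_ge0 (powR76_p0 R)) (ler_wpM2l lC_ge0 (powR2_p0 R)).
move=> /le_trans/(_ bound) le_chord.
rewrite powRM; [|lra|lra]; rewrite -expr2.
have : ((1 + t) `^ p0 R) ^+ 2 <= (l * (80 / 71) + (1 - l) * (171 / 100)) ^+ 2.
  by apply: lerXn2r; rewrite ?nnegrE ?powR_ge0 //; lra.
move=> /le_trans; apply; rewrite /l.
have := sqr_ge0 (s - 57 / 100); nra.
Qed.

Lemma fourth_root (R : realType) (b t : R) : 0 <= b -> b ^+ 4 < t -> t <= 1 ->
  exists u : R, [/\ 0 < u, b < u, u <= 1 & u ^+ 4 = t].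
Proof.
move=> b_ge0 b_lt t_le1.
have t_gt0 : 0 < t by apply: le_lt_trans b_lt; rewrite exprn_ge0.
have u_gt0 : 0 < t `^ 4^-1 by apply: powR_gt0.
have u4 : (t `^ 4^-1) ^+ 4 = t.
  by rewrite -powRXn ?(ltW t_gt0) // -(powR_mulrn 4 (ltW t_gt0)) -powRrM mulfV
     ?pnatr_eq0 // powRr1 // ltW.
exists (t `^ 4^-1); split=> //.
  by rewrite -(ltr_pXn2r (n := 4)) ?nnegrE ?(ltW u_gt0) // u4.
by rewrite -(ler_pXn2r (n := 4)) ?nnegrE ?(ltW u_gt0) // u4 expr1n.
Qed.

(** AM-GM gives 2 + s + s ^ 2 >= 4 s ^ (3/4) = (6 t ^ (3/4)) ^ p, which leaves a
    polynomial inequality in u = t ^ (1/4) on the short interval u > 0.924. *)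
Lemma two_one_ineq (R : realType) (t : R) : 0 <= t <= 1 ->
  1 < removal_threshold t - t ->
  ((1 + t) * (2 + t)) `^ p0 R <= 2 + t `^ p0 R + (t `^ p0 R) ^+ 2.
Proof.
move=> /andP[t_ge0 t_le1]; rewrite /removal_threshold => t_big.
have t_gt : 73 / 100 < t by nra.
have [||u [u_gt0 u_gt u_le1 u4]] := @fourth_root R (924 / 1000) t _ _ t_le1;
  [lra | lra |].
pose v := u `^ p0 R.
have v_ge0 : 0 <= v by apply: powR_ge0.
have sE : t `^ p0 R = v ^+ 4.
  by rewrite -u4 powRXn // ltW.
(* AM-GM in two steps, with equality at v = 1 *)
have amgm : 4 * v ^+ 3 <= 2 + v ^+ 4 + (v ^+ 4) ^+ 2.
  have : 0 <= (1 - v) ^+ 2 * (1 + 2 * v + 3 * v ^+ 2) + (1 - v ^+ 4) ^+ 2.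
    apply: addr_ge0 (sqr_ge0 _); apply: mulr_ge0 (sqr_ge0 _) _.
    by have := sqr_ge0 v; lra.
  by lra.
rewrite sE; apply: le_trans amgm.
have -> : 4 * v ^+ 3 = (6 * u ^+ 3) `^ p0 R.
  by rewrite powRM ?exprn_ge0 ?(ltW u_gt0) // powR6_p0 powRXn // ltW.
apply: ler_powRp; [exact/ltW/p0_gt0 | by rewrite mulr_ge0; lra |].
rewrite -u4 -subr_ge0; set e := 1 - u.
have e_ge0 : 0 <= e by rewrite subr_ge0.
have e_le : e <= 76 / 1000 by rewrite /e; lra.
have -> : u = 1 - e by rewrite /e; ring.
have -> : 6 * (1 - e) ^+ 3 - (1 + (1 - e) ^+ 4) * (2 + (1 - e) ^+ 4) =
  e * (2 - 28 * e + 62 * e ^+ 2 - 73 * e ^+ 3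
       + e ^+ 4 * (56 - 28 * e + 8 * e ^+ 2 - e ^+ 3)) by ring.
have e2_ge0 : 0 <= e ^+ 2 by apply: sqr_ge0.
have e3_le : e ^+ 3 <= 76 / 1000 * e ^+ 2 by rewrite exprS ler_wpM2r.
rewrite mulr_ge0 // addr_ge0 //; first by nra.
by rewrite mulr_ge0 ?exprn_ge0 //; nra.
Qed.

(** The p-mean of 1, t, ..., t ^ (n-1) is at least their 3/4-mean, and
    t ^ (3/4) = u ^ 3 for t = u ^ 4. The constant c is a lower bound for n ^ (1/p). *)
Lemma mean_of_powers (R : realType) (n : nat) (c u Q : R) :
  (0 < n)%N -> 0 < c -> c `^ p0 R <= n%:R -> 0 < u -> 0 <= Q ->
  n%:R ^+ 4 * Q ^+ 3 <= c ^+ 3 * (\sum_(i < n) u ^+ (3 * i)) ^+ 4 ->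
  Q `^ p0 R <= \sum_(i < n) ((u ^+ 4) `^ p0 R) ^+ i.
Proof.
move=> n_gt0 c_gt0 c_le u_gt0 Q_ge0 le_Q.
have n_gt0R : 0 < n%:R :> R by rewrite ltr0n.
set r := p0 R * (4 / 3).
have r_ge1 : 1 <= r by have := p0_ge R; rewrite /r; lra.
pose xs := [seq u ^+ (3 * i) | i <- iota 0 n].
have size_xs : size xs = n by rewrite size_map size_iota.
pose A := \sum_(i < n) u ^+ (3 * i).
have AE : \sum_(x <- xs) x = A.
  by rewrite big_map /A -(big_mkord xpredT (fun i => u ^+ (3 * i))) /index_iota subn0.
have A_gt0 : 0 < A.
  rewrite /A; case: (n) n_gt0 => // n' _; rewrite big_ord_recl ltr_pwDl ?exprn_gt0 //.
  by apply: sumr_ge0 => i _; rewrite exprn_ge0 // ltW.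
have m_gt0 : 0 < A / n%:R by rewrite divr_gt0.
have xs_ge0 : all (fun x => 0 <= x) xs.
  by apply/allP => _ /mapP[i _ ->]; rewrite exprn_ge0 // ltW.
have := power_mean r_ge1 m_gt0 xs_ge0.
rewrite size_xs AE mulrC divfK ?gt_eqF // => /(_ erefl).
have -> : \sum_(x <- xs) x `^ r = \sum_(i < n) ((u ^+ 4) `^ p0 R) ^+ i.
  rewrite big_map -(big_mkord xpredT (fun i => ((u ^+ 4) `^ p0 R) ^+ i)).
  rewrite /index_iota subn0; apply: eq_bigr => i _.
  rewrite exprM powRXn ?exprn_ge0 ?(ltW u_gt0) //; congr (_ ^+ i).
  rewrite -(powR_mulrn 3 (ltW u_gt0)) -(powR_mulrn 4 (ltW u_gt0)) -!powRrM.
  by congr (_ `^ _); rewrite /r; field.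
apply: le_trans.
(* with c ^ p0 in place of n, both sides are powers of exponent p0 / 3 *)
apply: le_trans (ler_wpM2r (powR_ge0 _ _) c_le).
have third x : 0 <= x -> x `^ p0 R = (x ^+ 3) `^ (p0 R / 3).
  by move=> x_ge0; rewrite -powR_mulrn // -powRrM; congr (_ `^ _); field.
have fourth x : 0 <= x -> x `^ r = (x ^+ 4) `^ (p0 R / 3).
  by move=> x_ge0; rewrite -powR_mulrn // -powRrM; congr (_ `^ _); rewrite /r; field.
rewrite !third ?(ltW c_gt0) // fourth ?(ltW m_gt0) //.
rewrite -powRM ?exprn_ge0 ?(ltW c_gt0) ?(ltW m_gt0) //.
apply: ler_powRp; [by have := p0_gt0 R; lra | exact: exprn_ge0 |].
by rewrite expr_div_n mulrA ler_pdivlMr ?exprn_gt0 // mulrC.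
Qed.

(** With X = u + 1 / u and t = u ^ 4, this is the hypothesis of [mean_of_powers]
    for the sequence (1, t, t ^ 2), divided by 8 u ^ 18. Equality holds at X = 2.
    Without the common factor (X - 1) ^ 3 (X ^ 2 - 3) ^ 3, the difference of the
    two sides has positive slope there. *)
Lemma palindrome3 (R : realType) (X : R) : 2 <= X -> X <= 21 / 10 ->
  32 * (X ^+ 2 - 2) ^+ 3 * ((X ^+ 2 - 1) * (X ^+ 2 - 3)) ^+ 3
    <= 27 * (X ^+ 3 - 3 * X + 2) ^+ 2 * (X ^+ 3 - 3 * X) ^+ 4.
Proof.
move=> X_ge X_le; pose h := X - 2; have XE : X = 2 + h by rewrite /h; ring.
have h_ge0 : 0 <= h by rewrite subr_ge0.
have h_le : h <= 1 / 10 by rewrite /h; lra.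
rewrite -subr_ge0.
have -> : 27 * (X ^+ 3 - 3 * X + 2) ^+ 2 * (X ^+ 3 - 3 * X) ^+ 4 -
    32 * (X ^+ 2 - 2) ^+ 3 * ((X ^+ 2 - 1) * (X ^+ 2 - 3)) ^+ 3 =
  (X - 1) ^+ 3 * (X ^+ 2 - 3) ^+ 3 *
  (27 * (X - 1) * (X + 2) ^+ 2 * X ^+ 4 * (X ^+ 2 - 3)
   - 32 * (X ^+ 2 - 2) ^+ 3 * (X + 1) ^+ 3) by ring.
have h2_ge0 : 0 <= h ^+ 2 by apply: sqr_ge0.
have X2_ge : 0 <= X ^+ 2 - 3 by rewrite XE; lra.
have small k : h ^+ k.+1 <= h * (1 / 10) ^+ k.
  by rewrite exprS ler_wpM2l // lerXn2r ?nnegrE //; lra.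
apply: mulr_ge0; first by apply: mulr_ge0; apply: exprn_ge0; lra.
have := small 2; have := small 3; have := small 4; have := small 5.
have := small 6; have := small 7; have := small 8.
by rewrite XE; lra.
Qed.

(** The analogue for (1, t, t ^ 2, t ^ 3). Here the two sides agree to first order at
    X = 2, so the second order in h = X - 2 decides. Once the bases are replaced by
    cubics n and v in h, the coefficients of n ^ 4 dominate those of v ^ 3. *)
Lemma palindrome4 (R : realType) (X : R) : 2 <= X -> X <= 2053 / 1000 ->
  625 * ((X ^+ 2 - 2) ^+ 2 * ((X ^+ 2 - 2) ^+ 2 - 2)) ^+ 3
    <= 512 * ((X ^+ 3 - 3 * X) ^+ 2 + (X ^+ 3 - 3 * X) - 1) ^+ 4.
Proof.
move=> X_ge X_le; pose h := X - 2; have XE : X = 2 + h by rewrite /h; ring.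
have h_ge0 : 0 <= h by rewrite subr_ge0.
have h_le : h <= 53 / 1000 by rewrite /h; lra.
set Y := X ^+ 3 - 3 * X; set X2 := X ^+ 2 - 2.
have pow_ge0 k : 0 <= h ^+ k by apply: exprn_ge0.
have small k : h ^+ k.+3 <= h ^+ 3 * (53 / 1000) ^+ k.
  by rewrite -addn3 addnC exprD ler_wpM2l // lerXn2r ?nnegrE //; lra.
pose n := 1 + 9 * h + 111 / 5 * h ^+ 2 + 113 / 5 * h ^+ 3.
pose v := 1 + 12 * h + 47 * h ^+ 2 + 91 * h ^+ 3.
have n_le : 5 * n <= Y ^+ 2 + Y - 1.
  have := pow_ge0 4; have := pow_ge0 5; have := pow_ge0 6.
  by rewrite /n /Y XE; lra.
have v_ge : X2 ^+ 2 * (X2 ^+ 2 - 2) <= 8 * v.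
  have := pow_ge0 3; have := small 1; have := small 2; have := small 3.
  have := small 4; have := small 5.
  by rewrite /v /X2 XE; lra.
have U_ge0 : 0 <= X2 ^+ 2 * (X2 ^+ 2 - 2).
  have : 2 <= X2 by have := pow_ge0 2; rewrite /X2 XE; lra.
  by move=> X2_ge; rewrite mulr_ge0 ?sqr_ge0 //; nra.
have n_ge0 : 0 <= n.
  by have := pow_ge0 2; have := pow_ge0 3; rewrite /n; lra.
have v_ge0 : 0 <= v by lra.
have nv : v ^+ 3 <= n ^+ 4.
  have := pow_ge0 2; have := pow_ge0 3; have := pow_ge0 4; have := pow_ge0 5.
  have := pow_ge0 6; have := pow_ge0 7; have := pow_ge0 8; have := pow_ge0 9.
  have := pow_ge0 10; have := pow_ge0 11; have := pow_ge0 12.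
  by rewrite /n /v; lra.
have le_v : (X2 ^+ 2 * (X2 ^+ 2 - 2)) ^+ 3 <= (8 * v) ^+ 3.
  by apply: lerXn2r; rewrite ?nnegrE //; lra.
have le_n : (5 * n) ^+ 4 <= (Y ^+ 2 + Y - 1) ^+ 4.
  by apply: lerXn2r; rewrite ?nnegrE //; lra.
move: le_v le_n nv; rewrite !exprMn; lra.
Qed.

Lemma geometric3_ineq (R : realType) (t : R) : 0 <= t <= 1 ->
  t * (1 + t) < removal_threshold t ->
  ((1 + t) * (1 + t + t ^+ 2)) `^ p0 R
    <= 1 + t `^ p0 R + (t `^ p0 R) ^+ 2 + (t `^ p0 R) ^+ 3.
Proof.
move=> /andP[t_ge0 t_le1]; rewrite /removal_threshold => t_big.
(* thus u > 0.73 below, and u + 1 / u <= 2.1 *)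
have t_gt : 2 / 7 < t by nra.
have [||u [u_gt0 u_gt u_le1 u4]] := @fourth_root R (73 / 100) t _ _ t_le1;
  [lra | lra |].
have := @mean_of_powers R 4 6 u ((1 + t) * (1 + t + t ^+ 2)).
rewrite !big_ord_recr !big_ord0 /= !add0r !muln0 muln1 !expr0 expr1 u4; apply=> //.
- by rewrite powR6_p0.
- by rewrite mulr_ge0 //; have := sqr_ge0 t; lra.
have XE : u + u^-1 = (1 + u ^+ 2) / u by field; rewrite gt_eqF.
have X_ge : 2 <= u + u^-1.
  by rewrite XE ler_pdivlMr //; have := sqr_ge0 (u - 1); lra.
have X_le : u + u^-1 <= 21 / 10 by rewrite XE ler_pdivrMr //; nra.
have := palindrome3 X_ge X_le.
have u18_gt0 : 0 < 8 * u ^+ 18 by rewrite mulr_gt0 // exprn_gt0.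
move/(ler_wpM2l (ltW u18_gt0)); rewrite -u4 => le_u.
have {le_u} : 256 * ((1 + u ^+ 4) * (1 + u ^+ 4 + (u ^+ 4) ^+ 2)) ^+ 3 <=
  216 * (1 + u ^+ 3 + u ^+ 6 + u ^+ 9) ^+ 4.
  move: le_u; congr (_ <= _); field; exact: lt0r_neq0.
have -> : 4 ^+ 4 = 256 :> R by ring.
by have -> : 6 ^+ 3 = 216 :> R by ring.
Qed.

Lemma geometric4_ineq (R : realType) (t : R) : 0 <= t <= 1 ->
  t * (1 + t + t ^+ 2) < removal_threshold t ->
  ((1 + t) * (1 + t + t ^+ 2 + t ^+ 3)) `^ p0 R
    <= 1 + t `^ p0 R + (t `^ p0 R) ^+ 2 + (t `^ p0 R) ^+ 3 + (t `^ p0 R) ^+ 4.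
Proof.
move=> /andP[t_ge0 t_le1]; rewrite /removal_threshold => t_big.
(* thus u > 0.795 below, and u + 1 / u <= 2.053 *)
have t_gt : 2 / 5 < t.
  rewrite ltNge; apply/negP => t_le.
  have : 0 <= t * (2 - 5 * t) * (1 - t) by rewrite !mulr_ge0 //; lra.
  by lra.
have [||u [u_gt0 u_gt u_le1 u4]] := @fourth_root R (159 / 200) t _ _ t_le1;
  [lra | lra |].
have := @mean_of_powers R 5 8 u ((1 + t) * (1 + t + t ^+ 2 + t ^+ 3)).
rewrite !big_ord_recr !big_ord0 /= !add0r !muln0 muln1 !expr0 expr1 u4; apply=> //.
- exact: powR8_p0.
- by rewrite mulr_ge0 // ?addr_ge0 ?exprn_ge0.
have XE : u + u^-1 = (1 + u ^+ 2) / u by field; rewrite gt_eqF.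
have X_ge : 2 <= u + u^-1.
  by rewrite XE ler_pdivlMr //; have := sqr_ge0 (u - 1); lra.
have X_le : u + u^-1 <= 2053 / 1000 by rewrite XE ler_pdivrMr //; nra.
have := palindrome4 X_ge X_le.
have u24_gt0 : 0 < u ^+ 24 by rewrite exprn_gt0.
move/(ler_wpM2l (ltW u24_gt0)); rewrite -u4 => le_u.
have {le_u} : 625 * ((1 + u ^+ 4) * (1 + u ^+ 4 + (u ^+ 4) ^+ 2 + (u ^+ 4) ^+ 3)) ^+ 3 <=
  512 * (1 + u ^+ 3 + u ^+ 6 + u ^+ 9 + u ^+ 12) ^+ 4.
  move: le_u; congr (_ <= _); field; exact: lt0r_neq0.
have -> : 5 ^+ 4 = 625 :> R by ring.
by have -> : 8 ^+ 3 = 512 :> R by ring.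
Qed.

(** * The inequality for words *)

Fixpoint ratio_sum (R : realType) (l : seq R) : R :=
  if l is c :: l' then c * (1 + ratio_sum l') else 0.

Fixpoint ratio_max (R : realType) (p t : R) (l : seq R) : R :=
  if l is c :: l' then (Num.max c t) `^ p + c `^ p * ratio_max p t l'
  else t `^ p.

Definition word (R : realType) (t : R) (e : seq R) : bool :=
  all (fun c => (c == 1) || (c == t)) e.

Lemma ratio_sum_ge0 (R : realType) (t : R) (e : seq R) :
  0 <= t -> word t e -> 0 <= ratio_sum e.
Proof.
move=> t_ge0; elim: e => //= c e IHe /andP[/orP[]/eqP-> /IHe e_ge0];
  by rewrite mulr_ge0 // addr_ge0.
Qed.

Lemma ratio_sum_ge (R : realType) (t c : R) (e : seq R) :
  0 <= t <= 1 -> word t (c :: e) -> t <= ratio_sum (c :: e).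
Proof.
move=> /andP[t_ge0 t_le1] /= /andP[c_letter /(ratio_sum_ge0 t_ge0) e_ge0].
have tc : t <= c by case/orP: c_letter => /eqP ->.
by have := mulr_ge0 (le_trans t_ge0 tc) e_ge0; lra.
Qed.

(** Unless the first term can be removed, S lies below the threshold. The sums of
    the words not among the eight short ones are at least 2 + t, 1 + t + t ^ 2,
    t (2 + t), t (1 + 2 t) or t (1 + t + t ^ 2 + t ^ 3), according to their first
    letters; none of these is below the threshold. *)
Lemma word_ineq (R : realType) (t : R) (e : seq R) : 0 <= t <= 1 -> word t e ->
  ((1 + t) * (1 + ratio_sum e)) `^ p0 R <= 1 + ratio_max (p0 R) t e.
Proof.
move=> t01; have /andP[t_ge0 t_le1] := t01.
have max1 : Num.max 1 t = 1 by apply/max_idPl.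
have maxt : Num.max t t = t by apply/max_idPl.
have K_ge0 : 0 <= 1 + t by rewrite addr_ge0.
have p_gt0 := p0_gt0 R.
elim: e => [_|c e IHe we].
  rewrite /= addr0; apply: constant_ineq => //; first by rewrite powR1.
  by rewrite mulr1; have := powR2_p0 R; lra.
have [le_thr|lt_thr] := lerP (removal_threshold t) (ratio_sum (c :: e)).
  apply: le_trans (removal t01 le_thr) _; rewrite lerD2l.
  have /andP[c_letter we'] : word t (c :: e) by [].
  have e_ge0 := ratio_sum_ge0 t_ge0 we'.
  have c_ge0 : 0 <= c by case/orP: c_letter => /eqP ->.
  have cE : Num.max c t = c by case/orP: c_letter => /eqP ->.
  rewrite /= cE mulrCA powRM ?mulr_ge0 ?addr_ge0 //.
  by have := ler_wpM2l (powR_ge0 c (p0 R)) (IHe we'); lra.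
have t2_ge0 : 0 <= t ^+ 2 by apply: sqr_ge0.
have t3_ge0 : 0 <= t ^+ 3 by apply: exprn_ge0.
have tC_ge0 : 0 <= 1 - t by rewrite subr_ge0.
have ttC_ge0 : 0 <= t * (1 - t) by apply: mulr_ge0.
have tail_ge f g : word t (f :: g) -> t <= ratio_sum (f :: g).
  exact: ratio_sum_ge.
(* 17 / 40 is close to the minimum of 5 (1 + t + t ^ 2 + t ^ 3) - 3 (1 + 4 t) *)
have late w : t * (1 + t * (1 + w)) < removal_threshold t -> t * (1 + t) <= w -> False.
  rewrite /removal_threshold => lt_w /(ler_wpM2l t2_ge0).
  have := mulr_ge0 t_ge0 (sqr_ge0 (t - 17 / 40)).
  have := mulr_ge0 t2_ge0 (sqr_ge0 (t - 17 / 40)).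
  have := mulr_ge0 t_ge0 (mulr_ge0 t_ge0 (sqr_ge0 (t - 17 / 40))).
  by lra.
case/andP: (we) => /orP[]/eqP cE we'; rewrite {c}cE {IHe} in we lt_thr *.
- case: e we' we lt_thr => [|d e] we' we lt_thr.
    rewrite /= max1 powR1 addr0 mulr1 mul1r addrA -[1 + 1]/2.
    apply: constant_ineq => //; first by have := powR2_p0 R; lra.
    have -> : 2 * 2 = 4 :> R by ring.
    by have := powR4_p0 R; lra.
  case/andP: (we') => /orP[]/eqP dE we''; rewrite {d}dE in we' we lt_thr *.
    case: e we'' we' we lt_thr => [|f g] wfg _ _ lt_thr.
      rewrite /= max1 powR1 !addr0 !mulr1 !mul1r.
      have -> : 1 + (1 + 1) = 3 :> R by ring.
      have -> : 1 + (1 + (1 + t `^ p0 R)) = 3 + t `^ p0 R by ring.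
      apply: constant_ineq => //; first by apply: ler1_powR; [lra | exact/ltW/p0_lt1].
      have -> : 2 * 3 = 6 :> R by ring.
      by rewrite powR6_p0; lra.
    by have := tail_ge _ _ wfg; move: lt_thr; rewrite /= /removal_threshold; lra.
  case: e we'' we' we lt_thr => [|f g] wfg _ _ lt_thr.
    have thr : 1 < removal_threshold t - t by move: lt_thr => /=; lra.
    have := two_one_ineq t01 thr.
    rewrite /= max1 maxt powR1 !addr0 !mulr1 !mul1r.
    by congr (_ `^ _ <= _); ring.
  have := ler_wpM2l t_ge0 (tail_ge _ _ wfg).
  by move: lt_thr; rewrite [ratio_sum _]/= -/(ratio_sum (f :: g)) /removal_threshold; lra.
- case: e we' we lt_thr => [|d e] we' we lt_thr.
    have thr : t < removal_threshold t by move: lt_thr => /=; lra.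
    have := one_one_ineq t01 thr; rewrite /= maxt addr0 mulr1.
    by congr (_ `^ _ <= _); ring.
  case/andP: (we') => /orP[]/eqP dE we''; rewrite {d}dE in we' we lt_thr *.
    case: e we'' we' we lt_thr => [|f g] wfg _ _ lt_thr.
      have := one_two_ineq t01; rewrite /= max1 maxt powR1 !addr0 !mulr1 !mul1r.
      by congr (_ `^ _ <= _); ring.
    have := ler_wpM2l t_ge0 (tail_ge _ _ wfg).
    move: lt_thr; rewrite [ratio_sum _]/= -/(ratio_sum (f :: g)).
    by rewrite /removal_threshold; lra.
  case: e we'' we' we lt_thr => [|f e] we'' _ _ lt_thr.
    have thr : t * (1 + t) < removal_threshold t by move: lt_thr => /=; lra.
    have := geometric3_ineq t01 thr; rewrite /= maxt !addr0 !mulr1.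
    by congr (_ `^ _ <= _); ring.
  case/andP: (we'') => /orP[]/eqP fE we; rewrite {f}fE in we'' lt_thr *.
    have := mulr_ge0 t2_ge0 (ratio_sum_ge0 t_ge0 we).
    by move: lt_thr; rewrite /= mul1r /removal_threshold; lra.
  case: e we we'' lt_thr => [|k e] wke _ lt_thr.
    have thr : t * (1 + t + t ^+ 2) < removal_threshold t.
      by move: lt_thr => /=; lra.
    have := geometric4_ineq t01 thr; rewrite /= maxt !addr0 !mulr1.
    by congr (_ `^ _ <= _); ring.
  case: (late (ratio_sum [:: t, k & e])); first by [].
  by rewrite [ratio_sum _]/= -/(ratio_sum (k :: e)) ler_wpM2l // lerD2l tail_ge.
Qed.

(** * Reduction to words *)

Lemma convex_weight (R : realType) (x y z : R) : x <= y -> y <= z ->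
  exists2 l, 0 <= l <= 1 & y = l * z + (1 - l) * x.
Proof.
move=> xy yz; have [zx|zx_neq0] := eqVneq (z - x) 0.
  by exists 0; [rewrite lexx ler01 | lra].
have zx_gt0 : 0 < z - x by rewrite lt0r zx_neq0 subr_ge0 (le_trans xy).
exists ((y - x) / (z - x)); last by field.
rewrite divr_ge0 ?subr_ge0 ?(le_trans xy) //=.
by rewrite ler_pdivrMr // mul1r lerB.
Qed.

(** The constants A, C and a carry the part of the sequence that has already been
    moved to letters, so that the induction can proceed from left to right: a is the
    current term, C the sum so far, A the powers so far. *)
Lemma ratio_reduction (R : realType) (p t A C a : R) (l : seq R) :
  0 < p -> p < 1 -> 0 <= t <= 1 -> 0 < C -> 0 <= a ->
  all (fun c => 0 <= c <= 1) l ->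
  (forall e, word t e ->
     ((1 + t) * (C + a * ratio_sum e)) `^ p <= A + a `^ p * ratio_max p t e) ->
  ((1 + t) * (C + a * ratio_sum l)) `^ p <= A + a `^ p * ratio_max p t l.
Proof.
move=> p_gt0 p_lt1 t01; have /andP[t_ge0 t_le1] := t01.
have max1 : Num.max 1 t = 1 by apply/max_idPl.
have maxt : Num.max t t = t by apply/max_idPl.
have K_gt0 : 0 < 1 + t by rewrite ltr_pwDl.
elim: l A C a => [A C a _ _ _ /(_ [::] isT)//|c l IHl A C a C_gt0 a_ge0].
move=> /= /andP[/andP[c_ge0 c_le1] l01] words.
have S_ge0 : 0 <= ratio_sum l.
  elim: l l01 {IHl} => //= d l IH /andP[/andP[d_ge0 _] /IH S_ge0].
  by rewrite mulr_ge0 // addr_ge0.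
set M := ratio_max p t l; set B := (1 + t) * (a * (1 + ratio_sum l)).
have B_ge0 : 0 <= B by rewrite !mulr_ge0 ?addr_ge0 // ltW.
have KC_gt0 : 0 < (1 + t) * C by rewrite mulr_gt0.
have letter d : 0 <= d -> d = 1 \/ d = t ->
    ((1 + t) * C + B * d) `^ p <= A + (a * d) `^ p + (a * d) `^ p * M.
  move=> d_ge0 d_letter.
  have := IHl (A + (a * d) `^ p) (C + a * d) (a * d) _ _ l01.
  have -> : (1 + t) * (C + a * d + a * d * ratio_sum l) = (1 + t) * C + B * d.
    by rewrite /B; ring.
  apply; rewrite ?mulr_ge0 //; first by rewrite ltr_wpDr ?mulr_ge0.
  move=> e we; have wde : word t (d :: e).
    by apply/andP; split=> //; case: d_letter => ->; rewrite eqxx ?orbT.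
  have dE : Num.max d t = d by case: d_letter => ->.
  have := words _ wde; rewrite /= dE [(a * d) `^ p]powRM //; congr (_ `^ _ <= _); ring.
have -> : (1 + t) * (C + a * (c * (1 + ratio_sum l))) = (1 + t) * C + B * c.
  by rewrite /B; ring.
have mean := powR_mean_convex p_gt0 p_lt1 _ KC_gt0 B_ge0.
have le_pow x y : 0 <= x -> x <= y -> x `^ p <= y `^ p.
  by apply: ler_powRp; exact: ltW.
have end_t := letter t t_ge0 (or_intror erefl).
have [ct|tc] := leP c t.
  (* below t only the term c ^ p * M of the left side moves with c *)
  have p0 : 0 `^ p = 0 :> R by rewrite powR0 ?gt_eqF.
  have [w w01 cE] := convex_weight (le_pow _ _ (lexx 0) c_ge0) (le_pow _ _ c_ge0 ct).
  apply: le_trans (mean _ _ _ _ w01 t_ge0 (lexx 0) c_ge0 cE) _.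
  have /andP[w_ge0 w_le1] := w01; have wC_ge0 : 0 <= 1 - w by rewrite subr_ge0.
  have end_0 := words [::] isT; rewrite /= mulr0 addr0 in end_0.
  rewrite mulr0 addr0.
  apply: le_trans (lerD (ler_wpM2l w_ge0 end_t) (ler_wpM2l wC_ge0 end_0)) _.
  by rewrite cE p0 !powRM //; lra.
(* above t the left side is affine in c ^ p *)
have end_1 := letter 1 ler01 (or_introl erefl).
have [w w01 cE] := convex_weight (le_pow _ _ t_ge0 (ltW tc)) (le_pow _ _ c_ge0 c_le1).
apply: le_trans (mean _ _ _ _ w01 ler01 t_ge0 c_ge0 cE) _.
have /andP[w_ge0 w_le1] := w01; have wC_ge0 : 0 <= 1 - w by rewrite subr_ge0.
apply: le_trans (lerD (ler_wpM2l w_ge0 end_1) (ler_wpM2l wC_ge0 end_t)) _.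
by rewrite cE !powRM //; lra.
Qed.

Lemma ratio_ineq (R : realType) (t : R) (l : seq R) : 0 <= t <= 1 ->
  all (fun c => 0 <= c <= 1) l ->
  ((1 + t) * (1 + ratio_sum l)) `^ p0 R <= 1 + ratio_max (p0 R) t l.
Proof.
move=> t01 l01.
have := @ratio_reduction R (p0 R) t 1 1 1 l (p0_gt0 R) (p0_lt1 R) t01 ltr01 ler01 l01.
rewrite powR1 !mul1r; apply=> e we; rewrite !mul1r; exact: word_ineq.
Qed.

(** * From sequences to ratios *)

Definition ratios (R : realType) (Y : nat -> R) (i n : nat) : seq R :=
  [seq Y k.+1 / Y k | k <- iota i n].

(** Zero terms are harmless: the ratio is then 0, as division by 0 gives 0, and
    the next term is 0 too by monotonicity. *)
Lemma ratiosP (R : realType) (p t : R) (Y : nat -> R) (i n : nat) :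
  0 < p -> 0 <= t -> (forall k, 0 <= Y k) -> (forall k, Y k.+1 <= Y k) ->
  [/\ all (fun c => 0 <= c <= 1) (ratios Y i n),
      Y i * ratio_sum (ratios Y i n) = \sum_(k <- iota i n) Y k.+1 &
      Y i `^ p * ratio_max p t (ratios Y i n) =
      \sum_(k <- iota i n) Num.max (Y k.+1) (t * Y k) `^ p + (t * Y (i + n)%N) `^ p].
Proof.
move=> p_gt0 t_ge0 Y_ge0 Y_noninc; elim: n i => [|n IHn] i.
  by split; rewrite //= ?big_nil ?mulr0 // addn0 add0r powRM // mulrC.
have [all01 sumE maxE] := IHn i.+1.
set c := Y i.+1 / Y i.
have c_ge0 : 0 <= c by rewrite divr_ge0.
have cE : Y i * c = Y i.+1.
  have [Yi0|Yi_neq0] := eqVneq (Y i) 0; last by rewrite mulrC divfK.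
  rewrite Yi0 mul0r; apply/eqP; rewrite eq_le Y_ge0 /=.
  by rewrite -Yi0 Y_noninc.
have c_le1 : c <= 1.
  have [Yi0|Yi_neq0] := eqVneq (Y i) 0; first by rewrite /c Yi0 invr0 mulr0.
  by rewrite ler_pdivrMr ?mul1r // lt0r Yi_neq0 Y_ge0.
have ratiosE : ratios Y i n.+1 = c :: ratios Y i.+1 n by [].
rewrite ratiosE /= c_ge0 c_le1 all01 !big_cons; split=> //.
  by rewrite mulrA cE mulrDr mulr1 sumE.
rewrite mulrDr mulrA -!powRM // ?le_max ?c_ge0 // cE.
by rewrite maxr_pMr // cE [Y i * t]mulrC maxE addrA addSnnS.
Qed.

Theorem theorem1p5 (R : realType) :
  (forall (m : nat) (x : 'I_2 -> R) (y : 'I_m.+1 -> R),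
     (1 <= m)%N -> nonincr_nonneg x -> nonincr_nonneg y ->
     power_ineq (p0 R) x y) /\
  (forall (m : nat) (p : R), (2 <= m)%N -> p0 R < p ->
     exists (x : 'I_2 -> R) (y : 'I_m.+1 -> R),
       [/\ nonincr_nonneg x, nonincr_nonneg y & ~ power_ineq p x y]).
Proof.
split=> [m x y _ [x_noninc x_ge0] [y_noninc y_ge0]|m p m_ge2 p_gt].
  have p_gt0 := p0_gt0 R; set p := p0 R in p_gt0 *.
  rewrite /power_ineq; set x0 := x ord0; set x1 := x ord_max.
  have rhs_ge0 : 0 <= \sum_(k < m.+2) max_conv x y k `^ p.
    by apply: sumr_ge0 => k _; apply: powR_ge0.
  have x1_le : x1 <= x0 by apply: x_noninc.
  have [x0_0|x0_neq0] := eqVneq x0 0.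
    have -> : x1 = 0 by apply/eqP; rewrite eq_le x_ge0 andbT -x0_0.
    by rewrite x0_0 addr0 powR0 ?gt_eqF // mul0r.
  have x0_gt0 : 0 < x0 by rewrite lt0r x0_neq0 x_ge0.
  pose t := x1 / x0.
  have t01 : 0 <= t <= 1.
    by rewrite divr_ge0 ?x_ge0 //= ler_pdivrMr // mul1r.
  have x1E : x1 = x0 * t by rewrite mulrC divfK.
  have /andP[t_ge0 t_le1] := t01.
  pose Y k := if (k < m.+1)%N then y (inord k) else 0.
  have Y_ge0 k : 0 <= Y k by rewrite /Y; case: ifP.
  have Y_noninc k : Y k.+1 <= Y k.
    rewrite /Y; case: ifP => [lt_k|_]; last by case: ifP.
    by rewrite (ltnW lt_k) y_noninc // !inordK // ltnW.
  (* the index pairs (0, j) and (1, j) bound the maxima from below *)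
  have mcx0 (j : 'I_m.+1) : x0 * Y j <= max_conv x y j.
    rewrite /Y ltn_ord inord_val /max_conv.
    exact: (le_bigmax_cond _ (j := (ord0, j)) (fun ij => x ij.1 * y ij.2)).
  have mcx1 (j : 'I_m.+1) : x1 * Y j <= max_conv x y j.+1.
    rewrite /Y ltn_ord inord_val /max_conv.
    exact: (le_bigmax_cond _ (j := (ord_max, j)) (fun ij => x ij.1 * y ij.2)).
  have [all01 sumE maxE] := ratiosP 0 m p_gt0 t_ge0 Y_ge0 Y_noninc.
  have le_pow u v : 0 <= u -> u <= v -> u `^ p <= v `^ p.
    by apply: ler_powRp; exact: ltW.
  have sum_iota (F : nat -> R) : \sum_(k <- iota 0 m) F k = \sum_(k < m) F k.
    by rewrite -(big_mkord xpredT F) /index_iota subn0.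
  have := ratio_ineq t01 all01; set l := ratios Y 0 m in all01 sumE maxE *.
  have S_ge0 : 0 <= ratio_sum l.
    elim: (l) all01 => //= c l' IHl /andP[/andP[c_ge0 _] /IHl S_ge0].
    by rewrite mulr_ge0 // addr_ge0.
  move/(ler_wpM2l (powR_ge0 (x0 * Y 0) p)) => le_main.
  have sum_y : \sum_(j < m.+1) y j = Y 0 * (1 + ratio_sum l).
    rewrite mulrDr mulr1 sumE sum_iota.
    have -> : \sum_(j < m.+1) y j = \sum_(j < m.+1) Y j.
      by apply: eq_bigr => j _; rewrite /Y ltn_ord inord_val.
    by rewrite big_ord_recl.
  have lhsE : (x0 + x1) `^ p * (\sum_(j < m.+1) y j) `^ p =
      (x0 * Y 0) `^ p * ((1 + t) * (1 + ratio_sum l)) `^ p.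
    rewrite sum_y -!powRM ?mulr_ge0 ?addr_ge0 ?x_ge0 ?(ltW x0_gt0) //.
    by congr (_ `^ _); rewrite x1E; ring.
  rewrite lhsE; apply: le_trans le_main _.
  rewrite mulrDr mulr1 [X in _ + X * _]powRM ?(ltW x0_gt0) // -mulrA maxE add0n.
  rewrite sum_iota mulrDr mulr_sumr big_ord_recl big_ord_recr /=.
  rewrite lerD //; first by apply: le_pow (mcx0 ord0); rewrite mulr_ge0 // ltW.
  have max_ge0 k : 0 <= Num.max (Y k.+1) (t * Y k) by rewrite le_max Y_ge0.
  rewrite lerD //.
    apply: ler_sum => k _; rewrite -powRM ?(ltW x0_gt0) //.
    apply: le_pow; first by rewrite mulr_ge0 // ltW.
    rewrite maxr_pMr ?(ltW x0_gt0) // mulrA -x1E ge_max.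
    have := mcx0 (lift ord0 k); have := mcx1 (widen_ord (leqnSn m) k).
    by rewrite /= /bump /= add1n => -> ->.
  rewrite -powRM; [|exact: ltW|exact: mulr_ge0]; rewrite mulrA -x1E.
  apply: le_pow; first by rewrite mulr_ge0 ?x_ge0.
  exact: (mcx1 ord_max).
have p_gt0 : 0 < p by apply: lt_trans p_gt; exact: p0_gt0.
exists (fun=> 1), (fun j => if (j < 3)%N then 1 else 0).
split; first by split.
  split=> [i j ij|j]; last by case: ifP.
  case: ifP => [j_lt3|_]; last by case: ifP.
  by rewrite (leq_ltn_trans ij j_lt3).
have sum_head (n k : nat) : (n <= k)%N ->
    \sum_(j < k) (if (j < n)%N then 1 else 0) = n%:R :> R.
  move=> n_le; rewrite -big_mkcond -(big_ord_widen k (fun=> 1) n_le).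
  by rewrite sumr_const card_ord.
rewrite /power_ineq sum_head // -powRM ?addr_ge0 //; apply/negP; rewrite -ltNge.
have -> : (1 + 1) * 3 = 6 :> R by ring.
(* the maximum is at most 1 for k < 4 and 0 afterwards *)
apply: (@le_lt_trans _ _ 4).
  rewrite -(sum_head 4%N m.+2) //; apply: ler_sum => k _.
  have mc_le (b : R) : 0 <= b ->
      (forall j : 'I_m.+1, (j < 3)%N -> (k < 4)%N -> 1 <= b) ->
      max_conv (fun=> 1) (fun j : 'I_m.+1 => if (j < 3)%N then 1 else 0) k <= b.
    move=> b_ge0 b_ge; apply: bigmax_le => // -[i j] /= /eqP ijk.
    rewrite mul1r; case: ifP => // j_lt3; apply: (b_ge j j_lt3).
    rewrite -ijk -addnS; exact: (@leq_add i j.+1 1 3 (ltn_ord i) j_lt3).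
  case: ifP => [_|k_ge4].
    have le1 := mc_le 1 ler01 (fun _ _ _ => lexx 1).
    by have := ler_powRp (ltW p_gt0) (bigmax_ge_id _ _ _ _) le1; rewrite powR1.
  have -> : max_conv (fun=> 1) (fun j : 'I_m.+1 => if (j < 3)%N then 1 else 0) k
      = 0 :> R.
    apply/eqP; rewrite eq_le bigmax_ge_id andbT; apply: mc_le => // j _.
    by rewrite k_ge4.
  by rewrite powR0 ?gt_eqF.
rewrite -(powR6_p0 R) /powR pnatr_eq0 /= ltr_expR ltr_pM2r ?ln6_gt0 //.
Qed.
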